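(* Let $X$ be an infinite Hausdorff topological space. The following are equivalent: (1) $(Q(X),\tau_p)$ is Polish; (2) $(Q(X),\tau_p)$ is completely metrizable; (3) $(Q(X),\tau_p)$ is Čech-complete.
   Context: A function $f: X\to\mathbb{R}$ is quasicontinuous at $x\in X$ if for every open $V\subset\mathbb{R}$ with $f(x)\in V$ and every open $U\subset X$ with $x\in U$ there is a nonempty open set $W\subset U$ with $f(W)\subset V$; $f$ is quasicontinuous if it is quasicontinuous at every point of $X$. $Q(X)$ is the set of all quasicontinuous functions $X\to\mathbb{R}$. $\tau_p$ is the topology of pointwise convergence, i.e. the topology on $Q(X)$ as a subspace of $\mathbb{R}^X$ with the product topology. A Polish space is a separable completely metrizable space. A topological space is Čech-complete if it is a Tychonoff space and is a $G_\delta$ set in one (equivalently, in all) of its compactifications. *)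

(* Defs.v *)
From mathcomp Require Import all_boot all_order all_algebra.
From mathcomp Require Import all_classical all_reals all_analysis.
From mathcomp Require Import borel_hierarchy.

Set Implicit Arguments.
Unset Strict Implicit.
Unset Printing Implicit Defensive.

Import Order.TTheory GRing.Theory Num.Theory.
Import numFieldNormedType.Exports.

Local Open Scope classical_set_scope.
Local Open Scope ring_scope.

Section general_topology.
Variables T U : topologicalType.
Implicit Type h : T -> U.

Definition homeomorphism h :=
  [/\ bijective h, continuous h & forall A : set T, open A -> open (h @` A)].

(* [h] is a homeomorphism onto its range. *)
Definition embedding h :=
  [/\ injective h, continuous h &
      forall A : set T, open A ->
        exists2 B : set U, open B & h @` A = B `&` range h].

(* [U], together with the map [h], is a compactification of [T]. *)
Definition compactification h :=
  [/\ compact [set: U], hausdorff_space U, embedding h & dense (range h)].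

End general_topology.

Definition separable (T : topologicalType) :=
  exists2 D : set T, countable D & dense D.

Definition tychonoff_space (T : topologicalType) :=
  accessible_space T /\ completely_regular_space T.

Definition cech_complete (T : topologicalType) :=
  tychonoff_space T /\
  exists (K : topologicalType) (h : T -> K),
    compactification h /\ Gdelta (range h).

Definition complete_metric_space (R : realType) (M : metricType R) :=
  forall u : nat -> M, cauchy (u @ \oo) -> exists l : M, u @ \oo --> l.

Definition completely_metrizable (R : realType) (T : topologicalType) :=
  exists (M : metricType R) (h : T -> M),
    homeomorphism h /\ complete_metric_space M.

Definition polish (R : realType) (T : topologicalType) :=
  separable T /\ completely_metrizable R T.

Section quasicontinuity.
Variables (X Y : topologicalType).
Implicit Type f : X -> Y.

Definition quasicontinuous_at f (x : X) :=
  forall (V : set Y) (U : set X), open V -> V (f x) -> open U -> U x ->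
    exists W : set X, [/\ open W, W !=set0, W `<=` U & f @` W `<=` V].

Definition quasicontinuous f := forall x : X, quasicontinuous_at f x.

End quasicontinuity.

Definition Q (R : realType) (X : topologicalType) : set {ptws X -> R} :=
  [set f | quasicontinuous (f : X -> R)].
Arguments Q : clear implicits.

(* [(Q(X), tau_p)]: the subspace topology on [Q R X] inherited from the product
   space [{ptws X -> R}]. *)
Definition Qp (R : realType) (X : topologicalType) : topologicalType :=
  set_type (Q R X).

(* Main.v *)
From HB Require Import structures.
Require Import Defs.
From mathcomp Require Import all_boot all_order all_algebra.
From mathcomp Require Import all_classical all_reals all_analysis.
From mathcomp Require Import borel_hierarchy lra.

Set Implicit Arguments.
Unset Strict Implicit.
Unset Printing Implicit Defensive.

Import Order.TTheory GRing.Theory Num.Theory.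
Import numFieldNormedType.Exports.

Local Open Scope classical_set_scope.
Local Open Scope ring_scope.

(** Write Q for the space of quasicontinuous functions on X.

    Q takes every finite set of values (quasicontinuous_interpolation): a
    quasicontinuous function may be overwritten by a constant on the closure of
    an open set, because near a point of that closure the open set itself
    provides the nonempty open set required by quasicontinuity.  Hence Q is dense in the
    product of copies of the extended line, which is a compactification of Q
    whatever the cardinality of X.

    Complete metrizability implies Čech-completeness because a completely
    metrizable space is a Gdelta in every Hausdorff space in which it is densely
    embedded (completely_metrizable_Gdelta): the points of the closure at which
    the metric has oscillation zero are limits of Cauchy sequences.

    For the return to Polishness, Čech-completeness is used through a complete
    sequence of covers (cech_complete_covers).  It has two consequences.
    - X is countable (complete_covers_countable).  A point g of Q has, for each
      n, a basic neighbourhood inside a member of the n-th cover, and all these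
      neighbourhoods together constrain only countably many coordinates.  If
      some coordinate x were left free, interpolation would give functions
      agreeing with g on more and more of the constrained coordinates while
      tending to infinity at x; such a sequence has no cluster point,
      contrary to completeness of the covers.
    - The topology of Q is then generated by a sequence of real functions, the
      evaluations.  Rational boxes give separability (generating_separable).
      Adding to that sequence the inverses of the radii up to which balls fit
      in the n-th cover gives a metric that is complete
      (complete_covers_completely_metrizable): along a Cauchy sequence the
      radii stay away from zero, so that a tail of it lies in a member of
      each cover and has a cluster point. *)

(** * Quasicontinuous functions with prescribed values *)

Section finite_data.
Variables (X Y : topologicalType).
Implicit Types (f : X -> Y) (O : set X).

Lemma quasicontinuous_cst (c : Y) : quasicontinuous ((fun=> c) : X -> Y).
Proof.
move=> x V U _ Vc oU Ux; exists U; split => //; first by exists x.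
by move=> _ [z _ <-].
Qed.

(** At a point of [closure O] the trace of [O] on the given neighbourhood is the
    required open set, since the function is constant there; elsewhere the
    function agrees with [f] on a neighbourhood. *)
Lemma quasicontinuous_glue f O (c : Y) : open O -> quasicontinuous f ->
  quasicontinuous (fun z => if `[< closure O z >] then c else f z).
Proof.
move=> oO qf x V U oV + oU Ux; case: asboolP => [clOx Vc | nclOx Vfx].
  exists (U `&` O); split.
  - exact: openI.
  - rewrite setIC; apply: clOx; exact: open_nbhs_nbhs.
  - exact: subIsetl.
  - move=> _ [z [_ Oz] <-]; case: asboolP => // -[].
    exact: subset_closure.
have oU' : open (U `&` ~` closure O).
  by apply: openI => //; apply: closed_openC; exact: closed_closure.
have [W [oW W0 WU fWV]] := qf x _ _ oV Vfx oU' (conj Ux nclOx).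
exists W; split => //; first by move=> z /WU[].
move=> _ [z Wz <-]; case: asboolP => [clOz|_]; last by apply: fWV; exists z.
by have [_] := WU _ Wz.
Qed.

Lemma hausdorff_nbhs_avoid (x : X) (l : seq X) : hausdorff_space X ->
  x \notin l -> exists O, [/\ open O, O x & forall y, y \in l -> ~ closure O y].
Proof.
move=> hX; elim: l => [_|y l IH]; first by exists setT; split => //;
  exact: openT.
rewrite inE negb_or => /andP[xy /IH[V [oV Vx Vl]]].
move: hX; rewrite open_hausdorff => /(_ _ _ xy)[[A B]/= []].
rewrite !inE => Ax By [oA oB AB0].
exists (V `&` A); split => //; first exact: openI.
move=> z; rewrite inE => /orP[/eqP->|zl] cl; last first.
  by apply: (Vl z zl); apply: closure_subset cl; exact: subIsetl.
have [|w [[_ Aw] Bw]] := cl B; first exact: open_nbhs_nbhs.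
by have : (A `&` B) w by []; rewrite AB0.
Qed.

(** Points are added one at a time: the value at the new point is spread over the
    closure of an open set that avoids the points already treated. *)
Lemma quasicontinuous_interpolation (y0 : Y) (v : X -> Y) (l : seq X) :
  hausdorff_space X ->
  exists2 f, quasicontinuous f & forall x, x \in l -> f x = v x.
Proof.
move=> hX; elim: l => [|x l [f qf fv]].
  by exists (fun=> y0) => //; exact: quasicontinuous_cst.
have [xl|xl] := boolP (x \in l).
  by exists f => // z; rewrite inE => /orP[/eqP->|]; exact: fv.
have [V [oV Vx Vl]] := hausdorff_nbhs_avoid hX xl.
exists (fun z => if `[< closure V z >] then v x else f z).
  exact: quasicontinuous_glue.
move=> z; rewrite inE => /orP[/eqP->|zl].
  by case: asboolP => // -[]; exact: subset_closure.
by case: asboolP => [/(Vl _ zl)//|_]; exact: fv.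
Qed.

End finite_data.

(** * Neighbourhoods for pointwise convergence *)

Section pointwise_nbhs.
Variables (X : choiceType) (Y : topologicalType).

Lemma nbhs_ptws_box (f : {ptws X -> Y}) (P : X -> set Y) (l : seq X) :
  (forall x, x \in l -> nbhs (f x) (P x)) ->
  nbhs f [set g : {ptws X -> Y} | forall x, x \in l -> P x (g x)].
Proof.
elim: l => [_|x l IH fP].
  by apply: filterS filterT => g _ x; rewrite in_nil.
have nx : nbhs f [set g : {ptws X -> Y} | P x (g x)].
  have := @proj_continuous X (fun=> Y) x f (P x); apply.
  by apply: fP; rewrite mem_head.
have nl := IH (fun z zl => fP z (mem_behead (s := x :: l) zl)).
apply: filterS (filterI nx nl) => g [gx gl] z.
by rewrite inE => /orP[/eqP->//|]; exact: gl.
Qed.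

(** The sets containing a box around [f] form a filter, and this filter converges
    to [f] coordinatewise, hence in the product. *)
Lemma ptws_nbhs_box (f : {ptws X -> Y}) (U : set {ptws X -> Y}) : nbhs f U ->
  exists (l : seq X) (P : X -> set Y), (forall x, nbhs (f x) (P x)) /\
    forall g : {ptws X -> Y}, (forall x, x \in l -> P x (g x)) -> U g.
Proof.
pose F : set_system {ptws X -> Y} := [set U |
  exists (l : seq X) (P : X -> set Y),
  (forall x, nbhs (f x) (P x)) /\
  forall g : {ptws X -> Y}, (forall x, x \in l -> P x (g x)) -> U g].
have FF : Filter F.
  split.
  - by exists [::], (fun=> setT); split => // x; exact: filterT.
  - move=> A B [l [P [fP PA]]] [m [P' [fP' PB]]].
    exists (l ++ m), (fun x => P x `&` P' x); split.
      by move=> x; apply: filterI.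
    move=> g gP; split; [apply: PA|apply: PB] => x xl.
      by have [] := gP x; rewrite ?mem_cat ?xl.
    by have [] := gP x; rewrite ?mem_cat ?xl ?orbT.
  - move=> A B AB [l [P [fP PA]]]; exists l, P; split => // g /PA; exact: AB.
suff Ff : F --> f by exact: Ff.
apply/cvg_sup => x A; rewrite nbhsE => -[B [[C oC <-] Cx] BA].
exists [:: x], (fun y => [set z | x = y -> C z]); split.
  move=> y; have [<-|xy] := pselect (x = y).
    by apply: filterS (open_nbhs_nbhs (conj oC Cx)) => z Cz _.
  by apply: filterS filterT => z _ /xy.
by move=> g gP; apply: BA; apply: gP; rewrite ?inE.
Qed.

End pointwise_nbhs.

(** * Compactness of the extended line *)

(** An ultrafilter converges to the supremum of the points above which it lives. *)
Lemma ereal_compact (R : realType) : compact [set: \bar R].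
Proof.
rewrite compact_ultra => F UF _.
pose S := [set a : \bar R | F [set x | (a <= x)%E]].
have Fgt a : (a < ereal_sup S)%E -> F [set x | (a < x)%E].
  move=> /ereal_sup_gt[c Fc ac]; apply: filterS Fc => x /=.
  exact: lt_le_trans.
have Flt b : (ereal_sup S < b)%E -> F [set x | (x < b)%E].
  move=> Sb; have [|] := in_ultra_setVsetC [set x | (x < b)%E] UF => // Fb.
  have : S b by apply: filterS Fb => x /= /negP; rewrite -leNgt.
  by move=> /ereal_sup_ubound; rewrite leNgt Sb.
exists (ereal_sup S); split=> // A.
rewrite itv_nbhsE => -[[[[]/= r|[]] [[]/= s|[]]]][]// _; rewrite in_itv/=.
- move=> /andP[/Fgt Fr /Flt Fs] rsA; apply: filterS (filterI Fr Fs).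
  move=> x [rx xs].
  by apply: rsA; rewrite /= in_itv/= rx.
- rewrite andbT => /Fgt Fr rA; apply: filterS Fr => x rx.
  by apply: rA; rewrite /= in_itv/= rx.
- move=> /Flt Fs sA; apply: filterS Fs => x xs.
  by apply: sA; rewrite /= in_itv/=.
- by move=> _ A_; apply: filterS filterT => x _; apply: A_; rewrite /= in_itv.
Qed.

(** * Completely metrizable spaces inside Hausdorff spaces *)

Section metric_facts.
Variables (R : realType) (M : metricType R).

Lemma nbhs_mdistE (x : M) (A : set M) :
  nbhs x A <-> exists2 e : R, 0 < e & forall y, mdist x y < e -> A y.
Proof.
rewrite -nbhs_ballE; split=> -[e e0 eA]; exists e => //.
  by move=> y xy; apply: eA; rewrite ballEmdist.
by move=> y; rewrite ballEmdist; exact: eA.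
Qed.

Lemma cauchy_seqP (u : nat -> M) : cauchy (u @ \oo) <->
  forall e : R, 0 < e ->
    exists N, forall i j, (N <= i)%N -> (N <= j)%N -> mdist (u i) (u j) < e.
Proof.
rewrite -cauchy_ballP; split=> cu e e0.
  have [[A B] /= [[N _ NA] [N' _ NB]] AB] := cu e e0.
  exists (maxn N N') => i j; rewrite !geq_max => /andP[Ni _] /andP[_ N'j].
  by have := AB (u i, u j) (conj (NA _ Ni) (NB _ N'j)); rewrite /= ballEmdist.
have [N Nu] := cu e e0.
exists ([set x | exists2 i, (N <= i)%N & u i = x],
        [set x | exists2 i, (N <= i)%N & u i = x]) => /=.
  by split; exists N => // i Ni /=; exists i.
by move=> [x y] /= [[i Ni <-] [j Nj <-]]; rewrite ballEmdist; exact: Nu.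
Qed.

End metric_facts.

(** With [g] the homeomorphism onto a complete metric space, [G n] is the set of
    points near which [g] oscillates by less than [n.+1%:R^-1].  At a point [k]
    of all the [G n], points of the range chosen ever closer to [k] have a
    Cauchy image under [g]; if [l] is its limit, then every neighbourhood of
    [k] contains points of the range whose image is close to [l], which in a
    Hausdorff space forces [k] to be the image of the preimage of [l]. *)
Lemma completely_metrizable_Gdelta (R : realType) (T K : topologicalType)
    (h : T -> K) : completely_metrizable R T -> hausdorff_space K ->
  embedding h -> dense (range h) -> Gdelta (range h).
Proof.
move=> [M [g [[[g' gK g'K] cg og] completeM]]] hK [injh ch oh] dh.
pose small n (N : set K) := forall s t, N (h s) -> N (h t) ->
  mdist (g s) (g t) < n.+1%:R^-1.
pose G n := \bigcup_(N in [set N | open N /\ small n N]) N.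
exists G; first by move=> n; apply: bigcup_open => N [].
apply/seteqP; split=> [_ [t _ <-] n _|k Gk].
  pose B := [set s | mdist (g t) (g s) < n.+1%:R^-1 / 2].
  have nB : nbhs t B.
    apply: (cg t [set y | mdist (g t) y < n.+1%:R^-1 / 2]).
    by apply/nbhs_mdistE; exists (n.+1%:R^-1 / 2) => //; rewrite divr_gt0.
  have [U oU hU] := oh _ (open_interior B).
  have Uin s : U (h s) -> B s.
    move=> Us; have : (h @` B°) (h s) by rewrite hU; split => //; exists s.
    by move=> [r /interior_subset Br /injh <-].
  exists U => /=; last first.
    have : (h @` B°) (h t) by exists t.
    by rewrite hU => -[].
  split=> // r s /Uin Br /Uin Bs.
  rewrite (le_lt_trans (metric_triangle _ (g t) _))//.
  by rewrite [ltRHS]splitr ltrD// metric_sym.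
have {Gk} /choice[N NP] : forall n, exists N, [/\ open N, small n N & N k].
  by move=> n; have [N [oN sN] Nk] := Gk n I; exists N.
(* A finite intersection of the [N i] is open, hence meets the dense range. *)
have NW n W : open W -> W k ->
    exists t, W (h t) /\ forall i, (i <= n)%N -> N i (h t).
  elim: n W => [|n IH] W oW Wk.
    have [oN _ Nk] := NP 0%N.
    have [|x [[Wt Nt] [t _ tE]]] := dh (W `&` N 0%N) _ (openI oW oN).
      by exists k.
    by exists t; rewrite tE; split => // i; rewrite leqn0 => /eqP->.
  have [oN _ Nk] := NP n.+1.
  have [t [[Wt Nt] Nit]] := IH (W `&` N n.+1) (openI oW oN) (conj Wk Nk).
  exists t; split=> // i; rewrite leq_eqVlt => /orP[/eqP->//|].
  by rewrite ltnS; exact: Nit.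
have /choice[u uN] : forall n, exists t, forall i, (i <= n)%N -> N i (h t).
  by move=> n; have [t []] := NW n _ (@openT K) I; exists t.
have close n s t : (forall i, (i <= n)%N -> N i (h s)) ->
    (forall i, (i <= n)%N -> N i (h t)) -> mdist (g s) (g t) < n.+1%:R^-1.
  by move=> sN tN; have [_ + _] := NP n; apply; [exact: sN|exact: tN].
have [l ul] : exists l : M, (g \o u) @ \oo --> l.
  apply: completeM; apply/cauchy_seqP => e e0.
  have [n ne] : exists n, n.+1%:R^-1 < e.
    by have [n _ ne] := near_infty_natSinv_lt (PosNum e0); exists n;
      exact: (ne n (leqnn n)).
  exists n => i j ni nj; apply: lt_trans ne; apply: close => m mn; apply: uN.
    exact: leq_trans ni.
  exact: leq_trans nj.
exists (g' l) => //; apply: (hK _ _) => V' V nV' nV.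
have /nbhs_mdistE[e e0 eV'] : nbhs l [set y | V' (h (g' y))].
  have : nbhs (g' l) [set s | V' (h s)] by exact: ch.
  rewrite nbhsE => -[U [oU Ul] UV'].
  have := og _ oU; rewrite openE => /(_ l) /=.
  move=> /(_ (ex_intro2 _ _ _ Ul (g'K l))).
  by apply: filterS => _ [s Us <-] /=; rewrite gK; exact: UV'.
move: nV; rewrite nbhsE => -[U [oU Uk] UV].
(* [n] is large for two reasons: [N n] is small and [u n] is near the limit. *)
have [n [ne dn]] : exists n, n.+1%:R^-1 < e / 2 /\ mdist l (g (u n)) < e / 2.
  have e20 : 0 < e / 2 by rewrite divr_gt0.
  have [n1 _ n1e] := near_infty_natSinv_lt (PosNum e20).
  have : nbhs l [set y | mdist l y < e / 2] by apply/nbhs_mdistE; exists (e / 2).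
  move=> /ul[n2 _ n2e].
  exists (maxn n1 n2); split; first by apply: n1e; exact: leq_maxl.
  by apply: n2e; exact: leq_maxr.
have [t [Ut Nt]] := NW n U oU Uk.
exists (h t); split; last exact: UV.
rewrite -(gK t); apply: eV'.
rewrite (le_lt_trans (metric_triangle _ (g (u n)) _))// [ltRHS]splitr ltrD//.
by rewrite (lt_trans _ ne)//; apply: close => // i; exact: uN.
Qed.

(** * The space of quasicontinuous functions and its compactification *)

Section function_space.
Variables (R : realType) (X : topologicalType).
Implicit Types (q : Qp R X) (l : seq X).

Definition Qval q : X -> R := \val q.

Lemma Qval_inj q q' : (forall x, Qval q x = Qval q' x) -> q = q'.
Proof. by move=> qq'; apply: val_inj; apply/funext. Qed.

Lemma Qval_continuous x : continuous (fun q => Qval q x).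
Proof.
move=> q; apply: (@continuous_comp _ {ptws X -> R} _ _ (fun f => f x)).
  exact: initial_continuous.
exact: (@proj_continuous X (fun=> R)).
Qed.

(** The radii of finitely many coordinate neighbourhoods have a positive minimum. *)
Lemma Qp_nbhs_ball q (U : set (Qp R X)) : nbhs q U ->
  exists l (e : R), 0 < e /\
    forall q', (forall x, x \in l -> `|Qval q x - Qval q' x| < e) -> U q'.
Proof.
rewrite nbhsE => -[B [[C oC <-] Cq] BU].
have [l [P [qP PC]]] := ptws_nbhs_box (open_nbhs_nbhs (conj oC Cq)).
have [e [e0 eP]] : exists e : R, 0 < e /\
    forall x, x \in l -> forall y, `|Qval q x - y| < e -> P x y.
  elim: l {PC} => [|x l [e [e0 eP]]]; first by exists 1.
  have /nbhs_ballP[d d0 dP] := qP x.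
  exists (Num.min d e); split; first by rewrite lt_min d0.
  move=> z; rewrite inE => /orP[/eqP->|zl] y; rewrite lt_min => /andP[yd ye].
    exact: dP.
  exact: eP.
exists l, e; split=> // q' qq'; apply: BU; apply: PC => x xl.
by apply: eP => //; exact: qq'.
Qed.

Lemma Qp_interpolation (v : X -> R) l : hausdorff_space X ->
  exists q, forall x, x \in l -> Qval q x = v x.
Proof.
move=> hX; have [f qf fv] := quasicontinuous_interpolation 0 v l hX.
by exists (exist _ f (mem_set qf)).
Qed.

Lemma Qp_hausdorff : hausdorff_space (Qp R X).
Proof.
move=> p q pq; apply: Qval_inj => x; apply: (@Rhausdorff R) => A B pA qB.
have [r [rA rB]] := pq _ _ (Qval_continuous pA) (Qval_continuous qB).
by exists (Qval r x).
Qed.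

Lemma Qp_tychonoff : tychonoff_space (Qp R X).
Proof.
split; first by apply: hausdorff_accessible; exact: Qp_hausdorff.
exact: (@uniform_completely_regular R (set_type (Q R X))).
Qed.

(** The compactification of the function space: each coordinate line is completed by
    its two points at infinity. *)
Definition Qp_ereal q : {ptws X -> \bar R} := fun x => (Qval q x)%:E.

Lemma Qp_ereal_embedding : embedding Qp_ereal.
Proof.
split.
- move=> p q pq; apply: Qval_inj => x.
  by have [] := congr1 (fun k : {ptws X -> \bar R} => k x) pq.
- move=> q U /ptws_nbhs_box[l [P [qP PU]]].
  have : \forall q' \near q, forall x, x \in l -> P x (Qval q' x)%:E.
    elim: l {PU} => [|x l IH]; first by apply: filterS filterT.
    have nx : \forall q' \near q, P x (Qval q' x)%:E.
      exact: (@Qval_continuous x q _ (qP x)).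
    apply: filterS (filterI nx IH) => q' [q'x q'l] z.
    by rewrite inE => /orP[/eqP->//|]; exact: q'l.
  by apply: filterS => q' q'P; exact: PU.
- move=> A oA.
  exists (interior [set k | forall q, Qp_ereal q = k -> A q]).
    exact: open_interior.
  apply/seteqP; split=> [_ [q Aq <-]|k [/interior_subset kA [q _ qk]]];
    last first.
    by exists q => //; exact: kA.
  split; last by exists q.
  have [l [e [e0 eA]]] := Qp_nbhs_ball (open_nbhs_nbhs (conj oA Aq)).
  pose P x := [set y : \bar R | exists2 r : R, y = r%:E & `|Qval q x - r| < e].
  have : nbhs (Qp_ereal q)
      [set k : {ptws X -> \bar R} | forall x, x \in l -> P x (k x)].
    apply: nbhs_ptws_box => x _.
    apply/(@nbhs_ballP R R); exists e => // r qr; exists r => //.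
  apply: filterS => k kP q' q'k; apply: eA => x /kP[r].
  by rewrite -q'k => -[->].
Qed.

(** Every neighbourhood of an extended real contains a real, so a box contains a
    real-valued point, and interpolation applies at its finitely many
    constrained coordinates. *)
Lemma Qp_ereal_dense : hausdorff_space X -> dense (range Qp_ereal).
Proof.
move=> hX U [k Uk] oU.
have [l [P [kP PU]]] := ptws_nbhs_box (open_nbhs_nbhs (conj oU Uk)).
have /choice[v vP] : forall x, exists r : R, P x r%:E.
  move=> x; have := kP x; case: (k x) => [r|[M [_ MP]]|[M [_ MP]]].
  - by move=> /nbhs_singleton; exists r.
  - by exists (M + 1); apply: MP; rewrite lte_fin ltrDl.
  - by exists (M - 1); apply: MP; rewrite lte_fin gtrDl oppr_lt0.
have [q qv] := Qp_interpolation v l hX.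
exists (Qp_ereal q); split; last by exists q.
by apply: PU => x xl; rewrite /Qp_ereal qv.
Qed.

Lemma Qp_completely_metrizable_cech : hausdorff_space X ->
  completely_metrizable R (Qp R X) -> cech_complete (Qp R X).
Proof.
move=> hX cmQ; split; first exact: Qp_tychonoff.
have hK : hausdorff_space {ptws X -> \bar R}.
  by apply: (@hausdorff_product X (fun=> \bar R)) => _; exact: ereal_hausdorff.
exists {ptws X -> \bar R}, Qp_ereal; split.
  split => //.
  - have := @tychonoff X (fun=> \bar R) (fun=> setT) (fun=> @ereal_compact R).
    by congr (compact _); apply/seteqP; split.
  - exact: Qp_ereal_embedding.
  - exact: Qp_ereal_dense.
apply: completely_metrizable_Gdelta cmQ hK _ _.
  exact: Qp_ereal_embedding.
exact: Qp_ereal_dense.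
Qed.

End function_space.

(** * The metric of a sequence of real functions *)

Section seq_dist.
Variables (R : realType) (T : Type) (e : nat -> T -> R).
Implicit Types (x y z : T) (n : nat) (d : R).

(** The truncation at [n.+1%:R^-1] makes all but finitely many coordinates
    negligible, so that this distance induces the initial topology of [e]. *)
Definition seq_dist x y : R :=
  sup (range (fun n => Num.min n.+1%:R^-1 `|e n x - e n y|)).

Lemma seq_dist_ge n x y :
  Num.min n.+1%:R^-1 `|e n x - e n y| <= seq_dist x y.
Proof.
apply: ub_le_sup; last by exists n.
exists 1 => _ [m _ <-]; rewrite ge_min; apply/orP; left.
by rewrite invf_le1 ?ler1n.
Qed.

Lemma seq_dist_le d x y :
  (forall n, Num.min n.+1%:R^-1 `|e n x - e n y| <= d) -> seq_dist x y <= d.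
Proof.
move=> xyd; apply: ge_sup; last by move=> _ [n _ <-].
by exists (Num.min 1%:R^-1 `|e 0%N x - e 0%N y|), 0%N.
Qed.

Lemma seq_dist_coord n d x y : seq_dist x y < Num.min n.+1%:R^-1 d ->
  `|e n x - e n y| < d.
Proof.
rewrite lt_min => /andP[xyn]; apply: le_lt_trans.
have := seq_dist_ge n x y; rewrite ge_min => /orP[|//].
by rewrite leNgt xyn.
Qed.

Lemma seq_dist_coords N d x y : seq_dist x y < Num.min N.+1%:R^-1 d ->
  forall n, (n <= N)%N -> `|e n x - e n y| < d.
Proof.
rewrite lt_min => /andP[xyN xyd] n nN; apply: seq_dist_coord.
rewrite lt_min xyd andbT (lt_le_trans xyN)// lef_pV2 ?posrE ?ltr0n//.
by rewrite ler_nat.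
Qed.

Lemma seq_dist_small d : 0 < d -> exists N, forall x y,
  (forall n, (n <= N)%N -> `|e n x - e n y| < d) -> seq_dist x y <= d.
Proof.
move=> d0; have [N _ Nd] := near_infty_natSinv_lt (PosNum d0).
exists N => x y xyd; apply: seq_dist_le => n; rewrite ge_min.
have [nN|Nn] := leqP n N; first by rewrite (ltW (xyd _ nN)) orbT.
by rewrite (ltW (Nd n (ltnW Nn))).
Qed.

Lemma seq_dist_ge0 x y : 0 <= seq_dist x y.
Proof.
apply: le_trans (seq_dist_ge 0%N x y).
by rewrite le_min normr_ge0 invr_ge0 ler0n.
Qed.

Lemma seq_distxx x : seq_dist x x = 0.
Proof.
apply/eqP; rewrite eq_le; apply/andP; split.
  by apply: seq_dist_le => n; rewrite subrr normr0 ge_min lexx orbT.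
exact: seq_dist_ge0.
Qed.

Lemma seq_dist_sym x y : seq_dist x y = seq_dist y x.
Proof. by rewrite /seq_dist; under eq_fun do rewrite distrC. Qed.

Lemma seq_dist_triangle y x z : seq_dist x z <= seq_dist x y + seq_dist y z.
Proof.
apply: seq_dist_le => n.
apply: le_trans (lerD (seq_dist_ge n x y) (seq_dist_ge n y z)).
have := ler_distD (e n y) (e n x) (e n z).
have : 0 <= n.+1%:R^-1 :> R by rewrite invr_ge0 ler0n.
have := normr_ge0 (e n x - e n y); have := normr_ge0 (e n y - e n z).
move: (n.+1%:R^-1) `|e n x - e n z| `|e n x - e n y| `|e n y - e n z|.
move=> w a b c c0 b0 w0 abc; rewrite !minEle.
by case: (leP w a); case: (leP w b); case: (leP w c) => ? ? ?; lra.
Qed.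

Lemma seq_dist0 : (forall x y, (forall n, e n x = e n y) -> x = y) ->
  forall x y, seq_dist x y = 0 -> x = y.
Proof.
move=> sep x y xy0; apply: sep => n; apply/eqP; rewrite -subr_eq0 -normr_le0.
apply/ler_addgt0Pl => d d0; rewrite addr0 ltW//; apply: seq_dist_coord.
by rewrite xy0 lt_min d0 andbT invr_gt0 ltr0n.
Qed.

Lemma seq_dist_cauchy (u : nat -> T) :
  (forall n d, 0 < d -> exists K, forall i j, (K <= i)%N -> (K <= j)%N ->
     `|e n (u i) - e n (u j)| < d) ->
  forall d, 0 < d -> exists K, forall i j, (K <= i)%N -> (K <= j)%N ->
     seq_dist (u i) (u j) <= d.
Proof.
move=> cu d d0; have [N Nd] := seq_dist_small d0.
suff [K uK] : exists K, forall i j, (K <= i)%N -> (K <= j)%N ->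
    forall n, (n <= N)%N -> `|e n (u i) - e n (u j)| < d.
  by exists K => i j Ki Kj; apply: Nd; exact: uK.
elim: N {Nd} => [|N [K uK]].
  have [K uK] := cu 0%N d d0; exists K => i j Ki Kj n.
  by rewrite leqn0 => /eqP->; exact: uK.
have [K' uK'] := cu N.+1 d d0; exists (maxn K K') => i j.
rewrite !geq_max => /andP[Ki K'i] /andP[Kj K'j] n.
rewrite leq_eqVlt => /orP[/eqP->|]; first exact: uK'.
by rewrite ltnS; exact: uK.
Qed.

End seq_dist.

Section seq_metric.
Variables (R : realType) (T : choiceType) (e : nat -> T -> R).
Hypothesis sep : forall x y, (forall n, e n x = e n y) -> x = y.

(** The proof that [e] separates points is kept as an argument: the metric
    structure attached to this type needs it. *)
Definition seq_metric : Type := let _ := sep in T.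

HB.instance Definition _ := Choice.on seq_metric.
HB.instance Definition _ := isMetric.Build R seq_metric
  (seq_distxx e) (seq_dist0 sep) (seq_dist_sym e) (seq_dist_triangle e).

End seq_metric.

Section generating_sequence.
Variables (R : realType) (T : topologicalType).
Implicit Types (e : nat -> T -> R) (x y : T).

(** When the [e n] are continuous, this says that the topology is the initial
    topology of the sequence. *)
Definition generating e := forall x (U : set T), nbhs x U ->
  exists N (d : R), 0 < d /\
    forall y, (forall n, (n <= N)%N -> `|e n x - e n y| < d) -> U y.

Lemma near_seq_dist e x (d : R) : (forall n, continuous (e n)) -> 0 < d ->
  \forall y \near x, seq_dist e x y < d.
Proof.
move=> ce d0; have d20 : 0 < d / 2 by rewrite divr_gt0.
have [N Nd] := seq_dist_small e d20.
have : \forall y \near x, forall n, (n <= N)%N -> `|e n x - e n y| < d / 2.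
  elim: N {Nd} => [|N IH].
    have /cvgrPdist_lt/(_ _ d20) := ce 0%N x.
    by apply: filterS => y xy n; rewrite leqn0 => /eqP->.
  have /cvgrPdist_lt/(_ _ d20) := ce N.+1 x.
  apply: filterS2 IH => y xyN xyS n.
  by rewrite leq_eqVlt => /orP[/eqP->//|]; exact: xyN.
apply: filterS => y /Nd /le_lt_trans; apply.
by rewrite ltr_pdivrMr// ltr_pMr// ltr1n.
Qed.

Lemma seq_metric_homeomorphism e
    (sep : forall x y, (forall n, e n x = e n y) -> x = y) :
  (forall n, continuous (e n)) -> generating e ->
  homeomorphism (id : T -> seq_metric sep).
Proof.
move=> ce ge; split; first by exists id.
  move=> x A /(@nbhs_mdistE R (seq_metric sep))[d d0 dA].
  by apply: filterS (near_seq_dist x ce d0) => y xy; exact: dA.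
move=> A oA; rewrite image_id openE => x Ax.
have [N [d [d0 dA]]] := ge x A (open_nbhs_nbhs (conj oA Ax)).
apply/(@nbhs_mdistE R (seq_metric sep)).
exists (Num.min N.+1%:R^-1 d); first by rewrite lt_min d0 andbT invr_gt0 ltr0n.
by move=> y xy; apply: dA; exact: seq_dist_coords.
Qed.

(** A point is chosen in every nonempty box with rational centre, given by finitely
    many coordinates, and with radius [k.+1%:R^-1]. *)
Lemma generating_separable e : generating e -> separable T.
Proof.
move=> ge; have [[x0 _]|T0] := pselect (exists x : T, True).
  pose B (s : seq rat * nat) := [set x : T | forall i, (i < size s.1)%N ->
    `|e i x - ratr (nth 0 s.1 i)| < s.2.+1%:R^-1].
  exists (range (fun s => xget x0 (B s))).
    by apply: sub_countable (card_image_le _ _) _.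
  move=> U [x Ux] oU.
  have [N [d [d0 dU]]] := ge x U (open_nbhs_nbhs (conj oU Ux)).
  have d20 : 0 < d / 2 by rewrite divr_gt0.
  have [k _ /(_ k (leqnn k)) /= kd] := near_infty_natSinv_lt (PosNum d20).
  have k0 : 0 < k.+1%:R^-1 :> R by rewrite invr_gt0 ltr0n.
  have /choice[q qx] : forall i, exists q : rat, `|e i x - ratr q| < k.+1%:R^-1.
    move=> i; have [|q] := @rat_in_itvoo R (e i x - k.+1%:R^-1) (e i x).
      by rewrite gtrDl oppr_lt0.
    rewrite in_itv/= => /andP[xq qx]; exists q.
    by rewrite gtr0_norm ?subr_gt0// ltrBlDr -ltrBlDl.
  pose s := (mkseq q N.+1, k).
  have Bx : B s x.
    by move=> i; rewrite size_mkseq => iN; rewrite nth_mkseq//; exact: qx.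
  exists (xget x0 (B s)); split; last by exists s.
  have Bs : B s (xget x0 (B s)) by apply: (xgetPex x0); exists x.
  apply: dU => n nN.
  rewrite (le_lt_trans (ler_distD (ratr (q n)) _ _))// [ltRHS]splitr.
  rewrite ltrD//; first exact: lt_trans (qx n) kd.
  have := Bs n; rewrite size_mkseq ltnS nth_mkseq// => /(_ nN).
  by rewrite distrC => /lt_trans; apply.
exists set0 => // U [x Ux].
by exfalso; apply: T0; exists x.
Qed.

End generating_sequence.

(** * Complete sequences of covers *)

(** A complete sequence of covers in the sense of Frolík and Arhangel'skii.  The
    members of the covers need not be open: it is enough that their
    interiors cover the space. *)
Definition complete_covers (T : topologicalType) (C : nat -> set (set T)) :=
  (forall n (x : T), exists2 U, C n U & nbhs x U) /\
  forall F : set_system T, ProperFilter F ->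
    (forall n, exists2 U, C n U & F U) -> cluster F !=set0.

(** If the space is the intersection of the open sets [G n] of its
    compactification, the n-th cover consists of the sets whose closure lies in
    [G n]; regularity of the compactification makes it a cover.  A filter meeting
    every cover has a cluster point in the compactification, which lies in
    every [G n]. *)
Lemma cech_complete_covers (T : topologicalType) :
  cech_complete T -> exists C : nat -> set (set T), complete_covers C.
Proof.
move=> [_ [K [h [[cK hK [injh ch oh] _] [G oG rangeG]]]]].
exists (fun n => [set U | closure (h @` U) `<=` G n]); split.
  move=> n x; have Gx : nbhs (h x) (G n).
    apply: open_nbhs_nbhs; split => //.
    by have : range h (h x) by []; rewrite rangeG; exact.
  have [V nV VG] := compact_regular hK cK filterT Gx.
  exists (h @^-1` V); last exact: ch.
  by apply: subset_trans VG; apply: closure_subset => _ [y Vy <-].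
move=> F PF FC; have [k [_ Fk]] := cK (h @ F) (fmap_proper_filter h PF) filterT.
have : range h k.
  rewrite rangeG => n _; have [U UG FU] := FC n; apply: UG => B nB.
  by apply: Fk nB; apply: (@filterS T F _ U) FU => x Ux; exists x.
move=> [t _ tk]; exists t => A B FA.
rewrite nbhsE => -[V [oV Vt] VB]; have [W oW hV] := oh V oV.
have nW : nbhs k W.
  apply: open_nbhs_nbhs; split => //.
  have : (h @` V) (h t) by exists t.
  by rewrite hV tk => -[].
have [|_ [[a Aa <-] Wa]] := Fk (h @` A) W _ nW.
  by apply: (@filterS T F _ A) FA => x Ax; exists x.
exists a; split => //; apply: VB.
have : (h @` V) (h a) by rewrite hV; split => //; exists a.
by move=> [b Vb /injh <-].
Qed.

Section cover_radius.
Variables (R : realType) (T : Type) (e : nat -> T -> R) (C : set (set T)).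
Implicit Types (x y : T) (r : R).

(** The bound [1] keeps the supremum finite.  Nonpositive radii are allowed so that
    subtracting a distance from a radius always gives a radius. *)
Definition cover_radii x := [set r : R | r <= 1 /\
  exists2 U, C U & forall y, seq_dist e x y < r -> U y].
Definition cover_radius x := sup (cover_radii x).

Lemma cover_radii_ub x : has_ubound (cover_radii x).
Proof. by exists 1 => r []. Qed.

Lemma cover_radiusP x r : cover_radii x !=set0 -> r < cover_radius x ->
  exists2 U, C U & forall y, seq_dist e x y < r -> U y.
Proof.
move=> x0 /(sup_gt x0)[s [_ [U CU sU]] rs]; exists U => // y xy.
by apply: sU; exact: lt_trans rs.
Qed.

(** A ball of radius [r] around [x] contains the ball of radius
    [r - seq_dist e x y] around [y]. *)
Lemma cover_radius_lipschitz x y :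
  cover_radii x !=set0 -> cover_radii y !=set0 ->
  `|cover_radius x - cover_radius y| <= seq_dist e x y.
Proof.
suff le z w : cover_radii z !=set0 ->
    cover_radius z <= cover_radius w + seq_dist e z w.
  move=> x0 y0; have := le y x y0; have := le x y x0.
  rewrite [seq_dist e y x]seq_dist_sym ler_norml => xy yx.
  by apply/andP; split; lra.
move=> z0; apply: ge_sup => // r [r1 [U CU rU]].
rewrite -lerBlDr; apply: ub_le_sup; first exact: cover_radii_ub.
split.
  rewrite lerBlDr (le_trans r1)// lerDl.
  exact: seq_dist_ge0.
exists U => // t wt; apply: rU.
rewrite (le_lt_trans (seq_dist_triangle _ w _ _))//.
by rewrite addrC -ltrBrDr.
Qed.

End cover_radius.

(** The sequence [f] interleaves [e] with the inverses of the cover radii.  It still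
    generates the topology, and for the metric of [f] a Cauchy sequence keeps
    the inverse radii bounded; see the discussion at the top. *)
Lemma complete_covers_completely_metrizable (R : realType) (T : topologicalType)
    (e : nat -> T -> R) (C : nat -> set (set T)) :
  (forall n, continuous (e n)) ->
  (forall x y, (forall n, e n x = e n y) -> x = y) ->
  generating e -> complete_covers C -> completely_metrizable R T.
Proof.
move=> ce sep ge [Ccover Ccomplete].
pose phi n := cover_radius e (C n).
have radii n x : exists2 r, 0 < r & cover_radii e (C n) x r.
  have [U CU nU] := Ccover n x.
  have [N [d [d0 dU]]] := ge x U nU.
  exists (Num.min N.+1%:R^-1 d).
    by rewrite lt_min d0 andbT invr_gt0 ltr0n.
  split; first by rewrite ge_min invf_le1 ?ltr0n// ler1n.
  by exists U => // y xy; apply: dU; exact: seq_dist_coords.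
have radii0 n x : cover_radii e (C n) x !=set0.
  by have [r _ xr] := radii n x; exists r.
have phi0 n x : 0 < phi n x.
  have [r r0 xr] := radii n x; apply: lt_le_trans r0 _.
  by apply: ub_le_sup xr; exact: cover_radii_ub.
have cphi n : continuous (phi n).
  move=> x; apply/cvgrPdist_lt => d d0.
  apply: filterS (near_seq_dist x ce d0) => y; apply: le_lt_trans.
  exact: cover_radius_lipschitz.
pose f m x := if odd m then (phi m./2 x)^-1 else e m./2 x.
have fe n x : f n.*2 x = e n x by rewrite /f odd_double doubleK.
have fphi n x : f n.*2.+1 x = (phi n x)^-1.
  by rewrite /f /= odd_double /= uphalf_double.
have cf m : continuous (f m).
  move=> x; rewrite /f; case: odd; last exact: ce.
  by apply: cvgV; [rewrite gt_eqF|exact: cphi].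
have sepf x y : (forall n, f n x = f n y) -> x = y.
  by move=> xy; apply: sep => n; rewrite -!fe.
have gf : generating f.
  move=> x U nU; have [N [d [d0 dU]]] := ge x U nU.
  exists N.*2, d; split => // y xy; apply: dU => n nN.
  by rewrite -!fe; apply: xy; rewrite leq_double.
exists (seq_metric sepf), id; split; first exact: seq_metric_homeomorphism.
move=> u /cauchy_seqP cu.
have cfu n d : 0 < d -> exists K, forall i j, (K <= i)%N -> (K <= j)%N ->
    `|f n (u i) - f n (u j)| < d.
  move=> d0; have [|K uK] := cu (Num.min n.+1%:R^-1 d).
    by rewrite lt_min d0 andbT invr_gt0 ltr0n.
  by exists K => i j Ki Kj; apply: seq_dist_coord; exact: uK.
have ceu n d : 0 < d -> exists K, forall i j, (K <= i)%N -> (K <= j)%N ->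
    `|e n (u i) - e n (u j)| < d.
  by move=> /(cfu n.*2 d)[K uK]; exists K => i j Ki Kj; rewrite -!fe; exact: uK.
have tail K : (u @ \oo : set_system T) [set u i | i in [set i | (K <= i)%N]].
  by exists K => // i Ki /=; exists i.
have [n|q qu] := Ccomplete (u @ \oo : set_system T) _.
  have [K uK] := cfu n.*2.+1 1 ltr01.
  (* From [K] on, the inverse radii vary by less than [1]. *)
  pose r := (1 + (phi n (u K))^-1)^-1.
  have r0 : 0 < r by rewrite invr_gt0 addr_gt0// invr_gt0.
  have phir i : (K <= i)%N -> r < phi n (u i).
    move=> Ki; have := uK i K Ki (leqnn K); rewrite !fphi => /ltr_normlW.
    rewrite ltrBlDr => ui.
    by rewrite /r -[ltRHS]invrK ltf_pV2 ?posrE ?invr_gt0 ?addr_gt0 ?invr_gt0.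
  have r20 : 0 < r / 2 by rewrite divr_gt0.
  have [K' uK'] := seq_dist_cauchy ceu r20.
  pose m := maxn K K'.
  have [U CU rU] := cover_radiusP (radii0 n (u m)) (phir m (leq_maxl _ _)).
  exists U => //; apply: filterS (tail m) => _ [i mi <-]; apply: rU.
  rewrite (@le_lt_trans _ _ (r / 2))//.
    by apply: uK'; [exact: leq_maxr|apply: leq_trans mi; exact: leq_maxr].
  by rewrite ltr_pdivrMr// ltr_pMr// ltr1n.
(* A Cauchy sequence converges to each of its cluster points. *)
exists (q : seq_metric sepf) => A /nbhs_mdistE[d d0 dA].
have d20 : 0 < d / 2 by rewrite divr_gt0.
have [K uK] := cu _ d20.
have [_ [[i Ki <-] qi]] := qu _ _ (tail K) (near_seq_dist q cf d20).
exists K => // j Kj; apply: dA => /=.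
rewrite (le_lt_trans (metric_triangle _ (u i) _))// [ltRHS]splitr ltrD//.
exact: uK.
Qed.

(** * From Čech-completeness to Polishness *)

Section cech_complete_function_space.
Variables (R : realType) (X : topologicalType).

(** [l n] lists the coordinates constrained by a neighbourhood of [g] inside a member
    of the n-th cover.  If a coordinate [x] escapes all of them, [f k] agrees
    with [g] on the first lists and takes the value [k] at [x]. *)
Lemma complete_covers_countable (C : nat -> set (set (Qp R X))) :
  hausdorff_space X -> complete_covers C -> countable [set: X].
Proof.
move=> hX [Ccover Ccomplete].
have [g _] := Qp_interpolation (fun=> 0 : R) [::] hX.
have /choice[l lP] : forall n, exists l : seq X, exists2 U, C n U &
    forall q, (forall x, x \in l -> Qval q x = Qval g x) -> U q.
  move=> n; have [U CU gU] := Ccover n g.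
  have [l [e [e0 eU]]] := Qp_nbhs_ball gU.
  exists l, U => // q qg; apply: eU => x xl.
  by rewrite qg// subrr normr0.
suff lX : [set: X] = \bigcup_n [set` l n].
  by rewrite lX; apply: bigcup_countable => // n _; exact: finite_set_countable.
apply/esym; rewrite -subTset => x _; apply: contrapT => nxl.
pose L k := flatten [seq l n | n <- iota 0 k.+1].
have lL n k y : (n <= k)%N -> y \in l n -> y \in L k.
  move=> nk yl; apply/flattenP; exists (l n) => //.
  by apply: map_f; rewrite mem_iota.
have xL k : x \notin L k.
  by apply/negP => /flattenP[_ /mapP[n _ ->] xl]; apply: nxl; exists n.
have /choice[f fP] : forall k : nat, exists f : Qp R X,
    Qval f x = k%:R /\ forall y, y \in L k -> Qval f y = Qval g y.
  move=> k.
  have [f fv] := Qp_interpolation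
    (fun y => if y == x then k%:R else Qval g y) (x :: L k) hX.
  exists f; split=> [|y yL]; first by rewrite fv ?mem_head// eqxx.
  rewrite fv ?inE ?yL ?orbT//; case: eqP => // yx.
  by move: (xL k); rewrite -yx yL.
have [n|q qf] := Ccomplete (f @ \oo : set_system _) _.
  have [U CU lU] := lP n; exists U => //; exists n => // k /= nk.
  by apply: lU => y yl; have [_] := fP k; apply; exact: lL yl.
have q1 : \forall h \near q, `|Qval q x - Qval h x| < 1.
  by have /cvgrPdist_lt/(_ _ ltr01) := @Qval_continuous R X x q.
pose K := (Num.truncn (Qval q x + 1)).+1.
have fK : (f @ \oo : set_system _) [set f k | k in [set k | (K <= k)%N]].
  by exists K => // k Kk; exists k.
have [_ [[k Kk <-]]] := qf _ _ fK q1.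
rewrite /= (fP k).1 distrC => /ltr_normlW; apply/negP; rewrite -leNgt lerBrDr.
rewrite addrC (le_trans (ltW (truncnS_gt _)))// ler_nat.
exact: Kk.
Qed.

Lemma complete_covers_polish (C : nat -> set (set (Qp R X))) :
  hausdorff_space X -> [set: X] !=set0 -> complete_covers C ->
  polish R (Qp R X).
Proof.
move=> hX [x0 _] CC.
have /countable_injP[i injI] := complete_covers_countable hX CC.
pose s n := xget x0 [set x | i x = n].
have is_ x : s (i x) = x.
  by apply: xget_unique => // y /= iy; apply: injI; rewrite ?inE.
pose e n (q : Qp R X) := Qval q (s n).
have ce n : continuous (e n) by exact: Qval_continuous.
have sep p q : (forall n, e n p = e n q) -> p = q.
  by move=> pq; apply: Qval_inj => x; have := pq (i x); rewrite /e is_.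
have ge : generating e.
  move=> q U /Qp_nbhs_ball[l [d [d0 dU]]].
  exists (\max_(x <- l) i x), d; split => // p qp; apply: dU => x xl.
  by have := qp (i x); rewrite /e is_; apply; exact: leq_bigmax_seq.
split; first exact: generating_separable ge.
exact: complete_covers_completely_metrizable CC.
Qed.

End cech_complete_function_space.

Theorem corollary3p2 (R : realType) (X : topologicalType)
  (X_hausdorff : hausdorff_space X) (X_infinite : infinite_set [set: X]) :
  [<-> polish R (Qp R X); completely_metrizable R (Qp R X);
       cech_complete (Qp R X)].
Proof.
tfae.
- by case.
- exact: Qp_completely_metrizable_cech.
- move=> /cech_complete_covers[C CC]; apply: complete_covers_polish CC => //.
  exact: infinite_setN0.
Qed.
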